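(* Let $G$ be a connected simple graph on $n\ge 1$ vertices, with diameter $\Delta(G)$, Wiener index $W(G)$, geometric mean of distance degrees $M(G)$, and distance Estrada index $DEE(G)$. Then $$ e^{\left(\frac{4W^2(G)-M^2(G)n}{n(n-1)}\right)^{\frac12}}+\frac{n-1}{e^{\frac{1}{n-1}\left(\frac{4W^2(G)-M^2(G)n}{n(n-1)}\right)^{\frac12}}} \le DEE(G)\le n-1+e^{\sqrt{2}\,\Delta(G)^{\frac12}\,W(G)^{\frac12}}, $$ where for $n=1$ the left-hand side is interpreted as $1$. Equality holds in the left inequality if and only if $G$ is the complete graph $K_n$. Equality holds in the right inequality if and only if $G=K_1$, i.e., $G$ is a single vertex.
   Context: Graphs are finite and simple. Let $G$ be a connected graph with vertex set $\{v_1,\dots,v_n\}$, and let $d_{ij}$ be the length of a shortest path between $v_i$ and $v_j$ (so $d_{ii}=0$). The distance matrix of $G$ is the real symmetric $n\times n$ matrix $D(G)=(d_{ij})$; let $\mu_1\ge\mu_2\ge\cdots\ge\mu_n$ be its eigenvalues (with multiplicity). The distance Estrada index is $DEE(G)=\sum_{i=1}^n e^{\mu_i}$. The distance degree of $v_i$ is $D_i=\sum_{j=1}^n d_{ij}$. The Wiener index is $W(G)=\sum_{i<j}d_{ij}=\frac12\sum_{i=1}^n D_i$. The geometric mean of the distance degrees is $M(G)=\left(\prod_{i=1}^n D_i\right)^{1/n}$. The diameter is $\Delta(G)=\max_{i,j}d_{ij}$. *)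

(* Defs.v *)
From HB Require Import structures.
From mathcomp Require Import all_boot all_order all_algebra.
From mathcomp Require Import all_classical all_reals all_analysis.

Set Implicit Arguments.
Unset Strict Implicit.
Unset Printing Implicit Defensive.

Import Order.TTheory GRing.Theory Num.Theory.
Import numFieldNormedType.Exports.

Local Open Scope ring_scope.

(* A simple graph on n labelled vertices is a symmetric irreflexive relation
   e : rel 'I_n. *)

Definition path_of_length (n : nat) (e : rel 'I_n) (i j : 'I_n) (k : nat)
    : bool :=
  [exists p : k.-tuple 'I_n,
     [&& path e i p, uniq (i :: p) & last i p == j]].

(* A path in a graph on n vertices has length less than n, so the search range
   is exhaustive; the value is n when i and j are not connected. *)
Definition gdist (n : nat) (e : rel 'I_n) (i j : 'I_n) : nat :=
  find (path_of_length e i j) (iota 0 n).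

Definition gdiameter (n : nat) (e : rel 'I_n) : nat :=
  (\max_(i < n) \max_(j < n) gdist e i j)%N.

Definition distance_degree (n : nat) (e : rel 'I_n) (i : 'I_n) : nat :=
  (\sum_(j < n) gdist e i j)%N.

Definition wiener_index (n : nat) (e : rel 'I_n) : nat :=
  (\sum_(i < n) \sum_(j < n | (i < j)%N) gdist e i j)%N.

Definition geometric_mean_degree (R : realType) (n : nat) (e : rel 'I_n) : R :=
  (\prod_(i < n) (distance_degree e i)%:R) `^ n%:R^-1.

Definition distance_matrix (R : realType) (n : nat) (e : rel 'I_n)
    : 'M[R]_n :=
  \matrix_(i, j) (gdist e i j)%:R.

(* s lists the eigenvalues of A in nonincreasing order, with (algebraic)
   multiplicity; such an s is unique, and it exists for A real symmetric. *)
Definition is_spectrum (R : realType) (n : nat) (A : 'M[R]_n) (s : seq R)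
    : Prop :=
  sorted >=%R s /\ char_poly A = \prod_(x <- s) ('X - x%:P).

(* The default [::] is returned only when char_poly A does not split over R. *)
Definition spectrum (R : realType) (n : nat) (A : 'M[R]_n) : seq R :=
  xget [::] [set s | is_spectrum A s]%classic.

Definition distance_estrada_index (R : realType) (n : nat) (e : rel 'I_n) : R :=
  \sum_(mu <- spectrum (distance_matrix R e)) expR mu.

(* Main.v *)
Require Import Defs.
From HB Require Import structures.
From mathcomp Require Import all_boot all_order all_algebra.
From mathcomp Require Import all_classical all_reals all_analysis.
From mathcomp Require Import complex ring lra.

Set Implicit Arguments.
Unset Strict Implicit.
Unset Printing Implicit Defensive.

Import Order.TTheory GRing.Theory Num.Theory.
Import numFieldNormedType.Exports.

Local Open Scope ring_scope.

(* Write mu_1 for the largest distance eigenvalue.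

   Lower bound: the eigenvalues sum to 0, so bounding exp from below by its
   tangents at r (for mu_1) and at -r/(n-1) (for the others) gives
   DEE >= e^r + (n-1) e^(-r/(n-1)) whenever 0 <= r <= mu_1, with equality only
   if mu_1 = r and all the other eigenvalues are -r/(n-1).  By Perron-Frobenius
   mu_1 is the spectral radius, so n mu_1^2 >= |D 1|^2 = sum_i D_i^2, and
   Kober's inequality
     (sum_i D_i)^2 <= (n-1) sum_i D_i^2 + n M^2
   turns this into mu_1 >= r for the r of the theorem.  In the equality case put
   t = r/(n-1): D + t I is positive semidefinite, so d_ij <= t off the diagonal,
   while sum_(i,j) d_ij^2 = tr D^2 = n(n-1)t^2; hence every d_ij is t, which must
   be 1 because some distance is 1.

   Upper bound: with b^2 = 2 Delta W >= tr D^2 every eigenvalue mu satisfies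
   |mu| <= b, and e^mu - 1 - mu <= (mu/b)^2 (e^b - 1 - b) term by term.  Summing,
   DEE <= n - 1 + e^b - b, which is strict in the stated bound unless b = 0. *)

(** * Spectral theorem for real symmetric matrices *)

Lemma char_poly_conj (F : fieldType) n (P D : 'M[F]_n) :
  P \in unitmx -> char_poly (invmx P *m D *m P) = char_poly D.
Proof.
move=> Pu; pose Q (M : 'M[F]_n) := map_mx polyC M.
have QP : Q (invmx P) *m Q P = 1%:M by rewrite /Q -map_mxM mulVmx // map_mx1.
have E : char_poly_mx (invmx P *m D *m P) =
    Q (invmx P) *m char_poly_mx D *m Q P.
  rewrite /char_poly_mx /Q !map_mxM mulmxBr mulmxBl; congr (_ - _).
  by rewrite scalar_mxC -mulmxA QP mulmx1.
by rewrite /char_poly E !det_mulmx mulrAC -det_mulmx QP det1 mul1r.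
Qed.


Section RealSpectral.
Local Open Scope sesquilinear_scope.

Lemma mulmx_conj_diag (F : fieldType) n (P : 'M[F]_n) (a b : 'rV[F]_n) :
  P \in unitmx ->
  (invmx P *m diag_mx a *m P) *m (invmx P *m diag_mx b *m P) =
  invmx P *m diag_mx (\row_k (a 0 k * b 0 k)) *m P.
Proof.
move=> Pu; rewrite !mulmxA mulmxK // -[_ *m diag_mx a *m _]mulmxA.
by rewrite mulmx_diag.
Qed.

Lemma trace_conj_diag (F : fieldType) n (P : 'M[F]_n) (a : 'rV[F]_n) :
  P \in unitmx -> \tr (invmx P *m diag_mx a *m P) = \sum_k a 0 k.
Proof.
by move=> Pu; rewrite mxtrace_mulC mulmxA mulmxV // mul1mx mxtrace_diag.
Qed.

Lemma form_conj_diag (C : numClosedFieldType) n (P : 'M[C]_n) (a x : 'rV[C]_n) :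
  P \is unitarymx -> x \is a realmx ->
  (x *m (invmx P *m diag_mx a *m P) *m x^T) 0 0 =
  \sum_k a 0 k * `|(x *m invmx P) 0 k| ^+ 2.
Proof.
move=> PU xR; set y := x *m invmx P.
(* As [P] is unitary and [x] is real, this conjugates the coordinates of [y], so that the form
   becomes a sum of squared moduli. *)
have yE : P *m x^T = y ^t*.
  rewrite /y trmx_mul map_mxM invmx_unitary // trmxCK; congr (_ *m _).
  by rewrite -map_trmx realmxC.
rewrite !mulmxA -/y -[_ *m P *m _]mulmxA yE mxE.
apply: eq_bigr => k _.
by rewrite mul_mx_diag !mxE mulrAC -normCK mulrC.
Qed.

(* [w k] is the squared modulus of the coordinate of [x] along the [k]-th vector
   of an orthonormal eigenbasis. *)
Lemma realmx_spectral (C : numClosedFieldType) n (A : 'M[C]_n) :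
  A \is symmetricmx -> A \is a realmx ->
  exists2 d : 'I_n -> C, forall k, d k \is Num.real &
  [/\ char_poly A = \prod_k ('X - (d k)%:P),
      \tr A = \sum_k d k, \tr (A *m A) = \sum_k d k ^+ 2 &
      forall x : 'rV_n, x \is a realmx -> exists w : 'I_n -> C,
      [/\ forall k, 0 <= w k,
          (x *m x^T) 0 0 = \sum_k w k,
          (x *m A *m x^T) 0 0 = \sum_k d k * w k &
          (x *m A *m A *m x^T) 0 0 = \sum_k d k ^+ 2 * w k]].
Proof.
move=> Asym AR; have AH := realsym_hermsym Asym AR.
have /orthomx_spectralP := hermitian_normalmx AH.
have /mxOverP dR := hermitian_spectral_diag_real AH.
have PU := spectral_unitarymx A.
move: (spectralmx A) (spectral_diag A) PU dR => P d PU dR AE.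
have Pu := unitarymx_unit PU.
have A2E : A *m A = invmx P *m diag_mx (\row_k (d 0 k ^+ 2)) *m P.
  by rewrite AE mulmx_conj_diag.
exists (d 0) => //; split.
- rewrite AE char_poly_conj // char_poly_trig ?diag_mx_is_trig //.
  by apply: eq_bigr => k _; rewrite mxE eqxx.
- by rewrite AE trace_conj_diag.
- by rewrite A2E trace_conj_diag //; apply: eq_bigr => k _; rewrite mxE.
move=> x xR; exists (fun k => `|(x *m invmx P) 0 k| ^+ 2); split.
- by move=> k; rewrite exprn_ge0.
- have := form_conj_diag (const_mx 1) PU xR.
  rewrite diag_const_mx mulmx1 mulVmx // mulmx1 => ->.
  by apply: eq_bigr => k _; rewrite mxE mul1r.
- by rewrite AE form_conj_diag.
- rewrite -(mulmxA x) A2E form_conj_diag //.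
  by apply: eq_bigr => k _; rewrite mxE.
Qed.

End RealSpectral.

(** Apply the complex spectral theorem to the image of [A] in the complex numbers over [R].
    Eigenvalues and weights are real there, so their real parts serve, and the identities descend
    because the embedding is injective. *)
Lemma realsym_spectral (R : rcfType) n (A : 'M[R]_n) : A^T = A ->
  exists d : 'I_n -> R,
  [/\ char_poly A = \prod_k ('X - (d k)%:P),
      \tr A = \sum_k d k, \tr (A *m A) = \sum_k d k ^+ 2 &
      forall x : 'rV_n, exists w : 'I_n -> R,
      [/\ forall k, 0 <= w k,
          (x *m x^T) 0 0 = \sum_k w k,
          (x *m A *m x^T) 0 0 = \sum_k d k * w k &
          (x *m A *m A *m x^T) 0 0 = \sum_k d k ^+ 2 * w k]].
Proof.
move=> Asym; pose f := real_complex R.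
have fR m p (B : 'M[R]_(m, p)) : map_mx f B \is a realmx.
  by apply/mxOverP => i j; rewrite mxE complex_real.
have Csym : map_mx f A \is symmetricmx.
  by apply/is_hermitianmxP; rewrite expr0 scale1r map_mx_id // map_trmx Asym.
have [dC dR [charC trC tr2C formC]] := realmx_spectral Csym (fR _ _ A).
pose d k := complex.Re (dC k).
have dE k : dC k = f (d k) by rewrite [RHS]RRe_real.
have entry (B : 'M[R]_1) : f (B 0 0) = (map_mx f B) 0 0 by rewrite mxE.
exists d; split.
- apply: (@map_poly_inj _ _ f); rewrite map_char_poly charC rmorph_prod /=.
  apply: eq_bigr => k _.
  by rewrite rmorphB /= map_polyX map_polyC /= dE.
- apply: (@complexI R); rewrite -trace_map_mx trC rmorph_sum /=.
  by apply: eq_bigr => k _; rewrite dE.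
- apply: (@complexI R); rewrite -trace_map_mx map_mxM tr2C rmorph_sum /=.
  by apply: eq_bigr => k _; rewrite dE -rmorphXn.
move=> x; have [wC [w_ge0 w1 w2 w3]] := formC _ (fR _ _ x).
pose w k := complex.Re (wC k).
have wE k : wC k = f (w k) by rewrite [RHS]RRe_real // ger0_real.
exists w; split.
- by move=> k; rewrite -ler0c -/f -wE.
- apply: (@complexI R); rewrite -/f entry map_mxM -map_trmx w1 /f rmorph_sum /=.
  by apply: eq_bigr => k _; rewrite wE.
- apply: (@complexI R); rewrite -/f entry !map_mxM -map_trmx w2 /f rmorph_sum /=.
  by apply: eq_bigr => k _; rewrite wE dE -rmorphM.
- apply: (@complexI R); rewrite -/f entry !map_mxM -map_trmx w3 /f rmorph_sum /=.
  by apply: eq_bigr => k _; rewrite wE dE -rmorphXn -rmorphM.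
Qed.

(** [spectrum] is picked by [xget], so only its defining property is available. Sorting the values
    of [d] shows that some spectrum exists, and the roots of a split polynomial are unique up to
    order. *)
Lemma sum_spectrum (R : realType) n (A : 'M[R]_n) (d : 'I_n -> R) (F : R -> R) :
  char_poly A = \prod_k ('X - (d k)%:P) ->
  \sum_(mu <- spectrum A) F mu = \sum_k F (d k).
Proof.
move=> charA; have : is_spectrum A (spectrum A).
  apply: (@xgetPex _ [::] [set s | is_spectrum A s]%classic).
  exists (sort >=%R [seq d k | k <- index_enum 'I_n]); split.
    by apply: sort_sorted => x y; exact: le_total.
  by rewrite charA (perm_big _ (permEl (perm_sort _ _))) /= big_map.
case=> _ charS; rewrite -[RHS](big_map d xpredT); apply: perm_big.
by apply: prod_XsubC_eq; rewrite -charS charA big_map.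
Qed.

(** * Rayleigh bounds and Perron-Frobenius *)

Lemma realsym_rayleigh (R : realType) n (A : 'M[R]_n) : A^T = A ->
  exists d : 'I_n -> R,
  [/\ char_poly A = \prod_k ('X - (d k)%:P),
      \tr A = \sum_k d k, \tr (A *m A) = \sum_k d k ^+ 2,
      forall (x : 'I_n -> R) a b, (forall k, a <= d k <= b) ->
        a * \sum_i x i ^+ 2 <= \sum_i \sum_j x i * A i j * x j
                            <= b * \sum_i x i ^+ 2 &
      forall (x : 'I_n -> R) b, (forall k, `|d k| <= b) ->
        \sum_j (\sum_i x i * A i j) ^+ 2 <= b ^+ 2 * \sum_i x i ^+ 2].
Proof.
move=> Asym; have [d [charA trA trA2 formA]] := realsym_spectral Asym.
exists d; split=> // x.
- move=> a b dab; have [w [w_ge0 w1 w2 _]] := formA (\row_i x i).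
  have -> : \sum_i x i ^+ 2 = \sum_k w k.
    by rewrite -w1 mxE; apply: eq_bigr => i _; rewrite !mxE.
  have -> : \sum_i \sum_j x i * A i j * x j = \sum_k d k * w k.
    rewrite -w2 mxE exchange_big; apply: eq_bigr => j _.
    by rewrite !mxE mulr_suml; apply: eq_bigr => i _; rewrite !mxE.
  rewrite !mulr_sumr; apply/andP; split; apply: ler_sum => k _;
    by rewrite ler_wpM2r //; case/andP: (dab k).
- move=> b db; have [w [w_ge0 w1 _ w3]] := formA (\row_i x i).
  have -> : \sum_i x i ^+ 2 = \sum_k w k.
    by rewrite -w1 mxE; apply: eq_bigr => i _; rewrite !mxE.
  have -> : \sum_j (\sum_i x i * A i j) ^+ 2 = \sum_k d k ^+ 2 * w k.
    have AxT y : A *m y^T = (y *m A)^T by rewrite trmx_mul Asym.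
    rewrite -w3 -mulmxA AxT mxE; apply: eq_bigr => j _.
    rewrite [X in _ = _ * X]mxE -expr2; congr (_ ^+ 2).
    by rewrite mxE; apply: eq_bigr => i _; rewrite mxE.
  rewrite mulr_sumr; apply: ler_sum => k _.
  rewrite ler_wpM2r // -(real_normK (num_real _)).
  by rewrite ler_pXn2r ?nnegrE // (le_trans _ (db k)).
Qed.

(* Perron-Frobenius: evaluate the form at the absolute values of an eigenvector. *)
Lemma nonneg_sym_max_eigenvalue (R : realType) n (A : 'M[R]_n) (d : 'I_n -> R) b :
  (forall i j, 0 <= A i j) ->
  char_poly A = \prod_k ('X - (d k)%:P) ->
  (forall x : 'I_n -> R,
     \sum_i \sum_j x i * A i j * x j <= b * \sum_i x i ^+ 2) ->
  forall k, `|d k| <= b.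
Proof.
move=> A_ge0 charA ray k.
have /eigenvalueP[v vA v0] : eigenvalue A (d k).
  rewrite eigenvalue_root_char charA (bigD1 k) //= rootM.
  by rewrite root_XsubC eqxx.
have v_gt0 : 0 < \sum_i v 0 i ^+ 2.
  rewrite lt0r sumr_ge0 ?andbT; last by move=> i _; exact: sqr_ge0.
  apply: contraNneq v0 => /eqP; rewrite psumr_eq0 => [|i _]; last exact: sqr_ge0.
  move=> /allP v_eq0; apply/eqP/rowP => i; rewrite mxE; apply/eqP.
  by rewrite -sqrf_eq0; apply: v_eq0; rewrite mem_index_enum.
rewrite -(ler_pM2r v_gt0).
have -> : \sum_i v 0 i ^+ 2 = \sum_i `|v 0 i| ^+ 2.
  by apply: eq_bigr => i _; rewrite real_normK ?num_real.
apply: le_trans (ray _).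
have -> : \sum_i `|v 0 i| ^+ 2 = `|\sum_i v 0 i ^+ 2|.
  rewrite gtr0_norm //.
  by apply: eq_bigr => i _; rewrite real_normK ?num_real.
rewrite -normrM mulr_sumr exchange_big /=.
apply: le_trans (ler_norm_sum _ _ _) _; apply: ler_sum => j _.
have -> : d k * v 0 j ^+ 2 = \sum_i v 0 i * A i j * v 0 j.
  by rewrite -mulr_suml expr2 mulrA; move/rowP/(_ j): vA; rewrite !mxE => ->.
apply: le_trans (ler_norm_sum _ _ _) _; apply: ler_sum => i _.
by rewrite !normrM (ger0_norm (A_ge0 i j)).
Qed.

(** * Tangent and remainder estimates for the exponential *)

Lemma expR_tangent (R : realType) (c x : R) : expR c * (1 + x - c) <= expR x.
Proof.
have -> : expR x = expR c * expR (x - c) by rewrite -expRD addrC subrK.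
by rewrite ler_wpM2l ?expR_ge0 // -addrA expR_ge1Dx.
Qed.

Lemma expR_tangent_eq (R : realType) (c x : R) :
  expR c * (1 + x - c) = expR x -> x = c.
Proof.
have -> : expR x = expR c * expR (x - c) by rewrite -expRD addrC subrK.
move/(mulfI (lt0r_neq0 (expR_gt0 c))) => E; apply/eqP; rewrite -subr_eq0.
apply/negPn/negP => /expR_gt1Dx; rewrite -E; lra.
Qed.

(** The power series compare term by term: x^(i+2) b^2 <= b^(i+2) x^2, since both sides contain (x
    b)^2 and x^i <= b^i. The inequality passes to the limit of the partial sums. *)
Lemma expR_remainder2_le (R : realType) (x b : R) : `|x| <= b ->
  (expR x - 1 - x) * b ^+ 2 <= (expR b - 1 - b) * x ^+ 2.
Proof.
move=> xb; pose rem (y : R) N := series (exp_coeff y) N - 1 - y.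
have rem_cvg y : (rem y @ \oo --> expR y - 1 - y)%classic.
  by apply: cvgB; [apply: cvgB; [exact: is_cvg_series_exp_coeff|exact: cvg_cst]
                  |exact: cvg_cst].
have rem_cvgM y a : ((fun N => rem y N * a) @ \oo --> (expR y - 1 - y) * a)%classic.
  by apply: cvgM; [exact: rem_cvg|exact: cvg_cst].
apply: (ler_cvg_to (rem_cvgM x (b ^+ 2)) (rem_cvgM b (x ^+ 2))).
(* From index 2 on, the partial sums contain the terms 1 and [y] that [rem] subtracts. *)
exists 2%N => // -[|[|N]] //= _.
have remE (y : R) : rem y N.+2 = \sum_(i < N) y ^+ i.+2 / i.+2`!%:R.
  rewrite /rem /series /= big_mkord !big_ord_recl /exp_coeff /=.
  rewrite /bump /= expr0 expr1 fact0 !divr1.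
  by ring.
rewrite !remE !mulr_suml; apply: ler_sum => i _.
rewrite mulrAC [leRHS]mulrAC ler_wpM2r ?invr_ge0 //.
have -> : x ^+ i.+2 * b ^+ 2 = x ^+ i * (x * b) ^+ 2 by rewrite !exprS; ring.
have -> : b ^+ i.+2 * x ^+ 2 = b ^+ i * (x * b) ^+ 2 by rewrite !exprS; ring.
rewrite ler_wpM2r ?sqr_ge0 // (le_trans (ler_norm _)) // normrX.
by rewrite lerXn2r ?nnegrE // (le_trans _ xb).
Qed.

(** * Kober's inequality *)

(* Kober's inequality for the numbers [expR t].  Removing the smallest [u], the
   induction step uses that [(expR t - expR u) ^+ 2] lies above its tangent, as a
   function of [t], at the mean [g] of the remaining exponents, where [u <= g]. *)
Lemma kober_expR (R : realType) (s : seq R) : sorted <=%R s -> s != [::] ->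
  (\sum_(t <- s) expR t) ^+ 2 <=
  ((size s)%:R - 1) * (\sum_(t <- s) expR t ^+ 2) +
  (size s)%:R * expR (2 * (\sum_(t <- s) t) / (size s)%:R).
Proof.
elim: s => // u s IHs us _.
case: (eqVneq s [::]) => [->|s0] /=.
  by rewrite !big_seq1 subrr mul0r add0r mul1r divr1 expRM_natl.
have {IHs} := IHs (path_sorted us) s0.
have /allP u_le := order_path_min le_trans us.
rewrite !big_cons -[(size s).+1%:R]natr1 addrK.
set m : R := (size s)%:R; set S := \sum_(t <- s) expR t.
set Q := \sum_(t <- s) _ ^+ 2; set T := \sum_(t <- s) t => IH.
have m_gt0 : 0 < m by rewrite ltr0n lt0n size_eq0.
have m_ge1 : 1 <= m by rewrite ler1n lt0n size_eq0.
pose g := T / m; pose G := expR g; pose y := expR (u - g).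
have G_gt0 : 0 < G := expR_gt0 g.
have y_gt0 : 0 < y := expR_gt0 _.
have XE : expR u = G * y by rewrite /G /y -expRD addrC subrK.
have sumC (a : R) : \sum_(t <- s) a = m * a.
  by rewrite big_const_seq count_predT iter_addr_0 mulr_natl.
have Tm : T = m * g by rewrite /g mulrC divfK // gt_eqF.
have u_le_g : u <= g.
  rewrite -(ler_pM2l m_gt0) -Tm /m -sumC /T big_seq [leRHS]big_seq.
  exact: ler_sum.
have y_le1 : y <= 1 by rewrite /y -expR0 ler_expR subr_le0.
have GE : expR (2 * T / m) = G ^+ 2.
  by rewrite /G -expRM_natl /g mulrA.
rewrite {}GE in IH.
(* The sum of the tangent bounds at [g], with the constant [expR u ^+ 2] dropped from both sides.
   The linear terms cancel because [g] is the mean of [s]. *)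
have QS : m * G ^+ 2 - 2 * m * G * (G * y) <= Q - 2 * (G * y) * S.
  have term t : G ^+ 2 - 2 * G * (G * y) + 2 * G * (G - G * y) * (t - g) <=
     expR t ^+ 2 - 2 * (G * y) * expR t.
    pose E := expR (t - g).
    have tE : expR t = G * E by rewrite /G /E -expRD addrC subrK.
    have E2 : 1 + 2 * (t - g) <= E ^+ 2.
      by rewrite /E -expRM_natl expR_ge1Dx.
    rewrite tE -subr_ge0.
    (* Since 0 < y <= 1, this writes the slack as G^2 times a convex combination of two nonnegative
       terms. *)
    have -> : (G * E) ^+ 2 - 2 * (G * y) * (G * E) -
       (G ^+ 2 - 2 * G * (G * y) + 2 * G * (G - G * y) * (t - g)) =
       G ^+ 2 * ((1 - y) * (E ^+ 2 - (1 + 2 * (t - g))) + y * (E - 1) ^+ 2).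
      by ring.
    rewrite mulr_ge0 ?sqr_ge0 // addr_ge0 // mulr_ge0 ?sqr_ge0 ?(ltW y_gt0) //;
    by rewrite subr_ge0.
  have sumE (a b : R) : \sum_(t <- s) (a + b * (t - g)) = m * a.
    by rewrite big_split /= sumC -mulr_sumr sumrB sumC -/T Tm subrr mulr0 addr0.
  have -> : m * G ^+ 2 - 2 * m * G * (G * y) = m * (G ^+ 2 - 2 * G * (G * y)).
    by ring.
  by rewrite -(sumE _ (2 * G * (G - G * y))) mulr_sumr -sumrB ler_sum.
(* Twice the mean of the full list is g + u + (m-1)(g-u)/(m+1), so [E] is what its squared geometric
   mean has beyond [expR g * expR u]. *)
pose E := expR ((m - 1) * (g - u) / (m + 1)).
have EE : expR (2 * (u + T) / (m + 1)) = G * (G * y) * E.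
  rewrite -XE /G /E -!expRD Tm; congr expR; field.
  by rewrite gt_eqF // ltr_wpDl // ltW.
have E1 : 1 + (m - 1) * (g - u) / (m + 1) <= E := expR_ge1Dx _.
have y1 : 1 + (u - g) <= y := expR_ge1Dx _.
rewrite XE EE.
(* Bound both exponentials by their tangents at 0: the multiples of g - u cancel. Multiplied by G^2
   y, this combines linearly with [IH] and [QS] into the goal. *)
have key : 2 * m <= (m - 1) * y + (m + 1) * E.
  have m1 : 0 < m + 1 by rewrite ltr_wpDl // ltW.
  have := ler_wpM2l (ltW m1) E1.
  rewrite mulrDr mulr1 [_ * (_ / _)]mulrC divfK ?gt_eqF // => {}E1.
  have := ler_wpM2l (_ : 0 <= m - 1) y1; rewrite subr_ge0 => /(_ m_ge1) {}y1.
  lra.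
have := ler_wpM2l (ltW (mulr_gt0 (exprn_gt0 2 G_gt0) y_gt0)) key.
lra.
Qed.

(** Take the sorted logarithms as exponents; every term is symmetric in the [a i], so sorting
    changes nothing. *)
Lemma kober (R : realType) n (a : 'I_n -> R) : (0 < n)%N ->
  (forall i, 0 < a i) ->
  (\sum_i a i) ^+ 2 <=
  (n%:R - 1) * (\sum_i a i ^+ 2) + n%:R * ((\prod_i a i) `^ n%:R^-1) ^+ 2.
Proof.
move=> n_gt0 a_gt0.
pose l := [seq ln (a i) | i <- index_enum 'I_n]; pose s := sort <=%R l.
have aK i : expR (ln (a i)) = a i by rewrite lnK // posrE.
have size_s : size s = n.
  by rewrite size_sort size_map [index_enum _]unlock -enumT size_enum_ord.
have sum_s (F : R -> R) : \sum_(t <- s) F t = \sum_i F (ln (a i)).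
  by rewrite (perm_big l) ?big_map // perm_sort.
have s_neq0 : s != [::] by rewrite -size_eq0 size_s -lt0n.
have := kober_expR (sort_sorted (@le_total _ R) l) s_neq0.
rewrite -/s size_s !sum_s.
have -> : \sum_i expR (ln (a i)) = \sum_i a i by apply: eq_bigr.
have -> : \sum_i expR (ln (a i)) ^+ 2 = \sum_i a i ^+ 2.
  by apply: eq_bigr => i _; rewrite aK.
have aP : \prod_i a i = expR (\sum_i ln (a i)).
  by rewrite expR_sum; apply: eq_bigr.
by rewrite -mulrA expRM_natl expRM -aP.
Qed.

(** * Sums of exponentials of numbers with sum zero *)

Lemma sum_const_neq (R : realType) n (m : 'I_n) (a : R) :
  \sum_(k | k != m) a = (n%:R - 1) * a.
Proof.
have : \sum_(k < n) a = n%:R * a by rewrite big_const_ord iter_addr_0 mulr_natl.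
by rewrite (bigD1 m) //=; lra.
Qed.

Lemma sum_expR_ge (R : realType) n (d : 'I_n -> R) (m : 'I_n) (r : R) :
  (1 < n)%N -> \sum_k d k = 0 -> 0 <= r <= d m ->
  let low := expR r + (n%:R - 1) / expR ((n%:R - 1)^-1 * r) in
  low <= \sum_k expR (d k) /\
  (low = \sum_k expR (d k) ->
   d m = r /\ forall k, k != m -> d k = - ((n%:R - 1)^-1 * r)).
Proof.
move=> n_gt1 d0 /andP[r_ge0 r_le] low; set q : R := n%:R - 1.
have q_gt0 : 0 < q by rewrite subr_gt0 ltr1n.
pose c := - (q^-1 * r).
have lowE : low = expR r + q * expR c by rewrite /low /c expRN.
have dmE : \sum_(k | k != m) d k = - d m.
  by apply/eqP; rewrite -addr_eq0 addrC; move: d0; rewrite (bigD1 m) //= => ->.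
(* The tangent values add up to [low] plus a term that is nonnegative because c <= 0 <= r <= d m.
   Hence equality with [low] makes every tangent inequality an equality. *)
have tangents : low + (d m - r) * (expR r - expR c) =
    expR r * (1 + d m - r) + \sum_(k | k != m) expR c * (1 + d k - c).
  rewrite -mulr_sumr sumrB big_split /= dmE !sum_const_neq -/q.
  have -> : q * c = - r by rewrite /c mulrN mulrA divff ?mul1r ?gt_eqF.
  rewrite lowE; ring.
have cr : expR c <= expR r.
  by rewrite ler_expR /c (le_trans _ r_ge0) // oppr_le0 mulr_ge0 // invr_ge0 ltW.
have gap_ge0 : 0 <= (d m - r) * (expR r - expR c).
  by rewrite mulr_ge0 // subr_ge0.
have le_tangents : expR r * (1 + d m - r) +
    \sum_(k | k != m) expR c * (1 + d k - c) <= \sum_k expR (d k).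
  rewrite [leRHS](bigD1 m) //= lerD ?expR_tangent // ler_sum // => k _.
  exact: expR_tangent.
split.
  by apply: le_trans le_tangents; rewrite -tangents lerDl.
move=> lowS.
have tangents_eq : expR r * (1 + d m - r) +
    \sum_(k | k != m) expR c * (1 + d k - c) = \sum_k expR (d k).
  by apply/eqP; rewrite eq_le le_tangents -lowS -tangents lerDl.
move: tangents_eq; rewrite [RHS](bigD1 m) //= => tangents_eq.
have rest_eq : \sum_(k | k != m) (expR (d k) - expR c * (1 + d k - c)) +
   (expR (d m) - expR r * (1 + d m - r)) = 0.
  rewrite sumrB; lra.
have rest_ge0 k : k != m -> 0 <= expR (d k) - expR c * (1 + d k - c).
  by move=> _; rewrite subr_ge0 expR_tangent.
move/eqP: rest_eq; rewrite paddr_eq0 ?sumr_ge0 ?subr_ge0 ?expR_tangent //.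
rewrite psumr_eq0 // subr_eq0 => /andP[/allP others /eqP top].
split; first by apply: expR_tangent_eq; rewrite top.
move=> k km; apply/expR_tangent_eq/esym/eqP; rewrite -subr_eq0.
by have := others k (mem_index_enum k); rewrite km.
Qed.

Lemma sum_expR_le (R : realType) n (d : 'I_n -> R) (b : R) :
  \sum_k d k = 0 -> 0 <= b -> \sum_k d k ^+ 2 <= b ^+ 2 ->
  \sum_k expR (d k) <= n%:R - 1 + expR b - b.
Proof.
move=> d0 b_ge0 d2.
have -> : \sum_k expR (d k) = n%:R + \sum_k (expR (d k) - 1 - d k).
  rewrite !sumrB d0 big_const_ord iter_addr_0; ring.
suff : \sum_k (expR (d k) - 1 - d k) <= expR b - 1 - b by lra.
have d_le k : `|d k| <= b.
  rewrite -(ler_pXn2r (n := 2)) ?nnegrE // real_normK ?num_real //.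
  apply: le_trans d2; rewrite (bigD1 k) //= lerDl sumr_ge0 // => i _.
  exact: sqr_ge0.
(* The remainder estimate is cancelled by b^2, so b = 0, where every [d k] vanishes, is treated
   apart. *)
move: b_ge0; rewrite le_eqVlt => /predU1P[b0|b_gt0].
  rewrite big1 => [|k _]; first by rewrite -b0 expR0; lra.
  by move: (d_le k); rewrite -b0 normr_le0 => /eqP ->; rewrite expR0; lra.
rewrite -(ler_pM2r (exprn_gt0 2 b_gt0)) mulr_suml.
apply: (@le_trans _ _ ((expR b - 1 - b) * \sum_k d k ^+ 2)).
  by rewrite mulr_sumr ler_sum // => k _; exact: expR_remainder2_le.
by rewrite ler_wpM2l // -addrA -opprD subr_ge0 expR_ge1Dx.
Qed.

(** * Distances in a graph *)

Lemma path_of_length0 n (e : rel 'I_n) i j : path_of_length e i j 0 = (i == j).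
Proof.
apply/existsP/idP => [[p]|ij]; first by rewrite tuple0 /=.
by exists [tuple].
Qed.

Lemma path_of_length1 n (e : rel 'I_n) i j :
  i != j -> path_of_length e i j 1 = e i j.
Proof.
move=> ij; apply/existsP/idP => [[p]|eij].
  case/tupleP: p => x p; rewrite tuple0 /= andbT.
  by case/and3P=> eix _ /eqP <-.
by exists [tuple j]; rewrite /= eij mem_seq1 ij eqxx.
Qed.

Lemma gdistxx n (e : rel 'I_n) i : gdist e i i = 0%N.
Proof.
case: n e i => [|n] e i; first by case: i.
by rewrite /gdist /= path_of_length0 eqxx.
Qed.

Lemma gdist_gt0 n (e : rel 'I_n) i j : i != j -> (0 < gdist e i j)%N.
Proof.
case: n e i j => [|n] e i j ij; first by case: i ij.
by rewrite /gdist /= path_of_length0 (negPf ij).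
Qed.

Lemma gdist_eq1 n (e : rel 'I_n) i j : i != j -> (gdist e i j == 1%N) = e i j.
Proof.
(* Distinct vertices force n >= 2, so length 1 lies in the search range and a failed search cannot
   return 1. *)
case: n e i j => [|[|n]] e i j ij; [by case: i ij | by rewrite !ord1 in ij |].
by rewrite /gdist /= path_of_length0 (negPf ij) path_of_length1 //; case: (e i j).
Qed.

Lemma path_of_length_sym n (e : rel 'I_n) i j k : symmetric e ->
  path_of_length e i j k -> path_of_length e j i k.
Proof.
move=> e_sym /existsP[p /and3P[pathp uniqp /eqP lastp]].
have size_r : size (rev (belast i p)) == k.
  by rewrite size_rev size_belast size_tuple.
apply/existsP; exists (Tuple size_r) => /=; apply/and3P; split.
- by rewrite -lastp rev_path; under eq_path do rewrite e_sym.
- rewrite -[_ && _]/(uniq (j :: rev (belast i p))).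
  have -> : j :: rev (belast i p) = rev (i :: p).
    by rewrite [i :: p]lastI lastp rev_rcons.
  by rewrite rev_uniq.
- by move: lastp; case: (tval p) => /= [->|x s _]; rewrite ?rev_cons ?last_rcons.
Qed.

Lemma gdist_sym n (e : rel 'I_n) i j : symmetric e -> gdist e i j = gdist e j i.
Proof.
move=> e_sym; apply: eq_find => k.
by apply/idP/idP; apply: path_of_length_sym.
Qed.

Lemma gdist_le_diameter n (e : rel 'I_n) i j : (gdist e i j <= gdiameter e)%N.
Proof.
apply: leq_trans (leq_bigmax i); exact: (leq_bigmax (F := gdist e i) j).
Qed.

Lemma sum_distance_degree n (e : rel 'I_n) : symmetric e ->
  (\sum_i distance_degree e i = 2 * wiener_index e)%N.
Proof.
move=> e_sym; rewrite mul2n -addnn {2}/wiener_index.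
(* The second copy of the Wiener index now runs over j < i; the diagonal contributes 0. *)
rewrite [X in (_ + X)%N](exchange_big_dep xpredT) //= -big_split /=.
apply: eq_bigr => i _.
rewrite /distance_degree (bigID (fun j : 'I_n => (i < j)%N)) /=.
congr (_ + _)%N; rewrite [LHS]big_mkcond [RHS]big_mkcond /=.
apply: eq_bigr => j _; rewrite -leqNgt leq_eqVlt.
case: ltnP; rewrite ?orbT ?orbF => _; first by rewrite gdist_sym.
by case: eqP => // /val_inj ->; rewrite gdistxx.
Qed.

(** A path between distinct vertices has a first step to a different vertex. Its ends are at
    distance 1, so t = 1. *)
Lemma gdist_const_complete n (e : rel 'I_n) (t : nat) :
  (1 < n)%N -> (forall i j, connect e i j) ->
  (forall i j, i != j -> gdist e i j = t) -> forall i j, i != j -> e i j.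
Proof.
move=> n_gt1 e_conn gt i j ij; rewrite -gdist_eq1 // gt //.
have /connectP[p] := e_conn i j.
elim: p i ij => [|x p IHp] i ij /=; first by move=> _ ji; rewrite ji eqxx in ij.
case/andP=> eix pathp lastp.
case: (eqVneq i x) => [ix|ix]; last by rewrite -(gt _ _ ix) gdist_eq1.
by apply: (IHp x) => //; rewrite -ix.
Qed.

(** * Eigenvalues of the distance matrix *)

(** The last clause serves the equality case of the lower bound: when all eigenvalues but the top
    one equal c, the matrix D - c I is positive semidefinite, which bounds the off-diagonal
    entries. *)
Lemma distance_spectrum (R : realType) n (e : rel 'I_n) :
  (0 < n)%N -> symmetric e ->
  exists (d : 'I_n -> R) (m : 'I_n),
  [/\ char_poly (distance_matrix R e) = \prod_k ('X - (d k)%:P),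
      \sum_k d k = 0,
      \sum_k d k ^+ 2 = \sum_i \sum_j (gdist e i j)%:R ^+ 2,
      \sum_i (distance_degree e i)%:R ^+ 2 <= n%:R * d m ^+ 2 &
      0 <= d m /\ forall c, c <= d m -> (forall k, k != m -> d k = c) ->
        forall i j, i != j -> (gdist e i j)%:R <= - c].
Proof.
move=> n_gt0 e_sym; set A := distance_matrix R e.
have Asym : A^T = A by apply/matrixP => i j; rewrite !mxE gdist_sym.
have [d [charA trA trA2 form form2]] := realsym_rayleigh Asym.
pose m := [arg max_(k > Ordinal n_gt0) d k]%O.
have d_le k : d k <= d m by rewrite /m; case: arg_maxP => //= i _; apply.
have abs_d : forall k, `|d k| <= d m.
  apply: (nonneg_sym_max_eigenvalue (A := A)) => // [i j|x]; first by rewrite mxE.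
  (* Any lower bound on the eigenvalues will do: only the upper Rayleigh bound is kept. *)
  pose lo := - \sum_k `|d k|.
  have /(form x) /andP[] // : forall k, lo <= d k <= d m.
  move=> k; rewrite d_le andbT lerNl (le_trans _ (_ : `|d k| <= _)) //.
    by rewrite -normrN ler_norm.
  by rewrite (bigD1 k) //= lerDl sumr_ge0.
exists d, m; split => //.
- by rewrite -trA /mxtrace big1 // => i _; rewrite mxE gdistxx.
- rewrite -trA2; apply: eq_bigr => i _; rewrite mxE; apply: eq_bigr => j _.
  by rewrite !mxE (gdist_sym j i e_sym) expr2.
(* The all-ones vector is mapped to the vector of distance degrees. *)
- have := form2 (fun=> 1) _ abs_d.
  rewrite mulrC; congr (_ <= _ * _).
    apply: eq_bigr => j _; rewrite natr_sum; congr (_ ^+ 2).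
    by apply: eq_bigr => i _; rewrite mul1r mxE gdist_sym.
  by rewrite expr1n big_const_ord iter_addr_0.
split=> [|c c_le dc i j ij]; first exact: le_trans (abs_d m).
have d_ge k : c <= d k <= d m.
  by rewrite d_le andbT; case: (eqVneq k m) => [->|/dc ->].
(* The difference of two basis vectors has squared norm 2 and form value -2 d_ij. *)
pose x (k : 'I_n) : R := (k == i)%:R - (k == j)%:R.
have sumx (F : 'I_n -> R) : \sum_k x k * F k = F i - F j.
  under eq_bigr do rewrite mulrBl.
  rewrite sumrB (bigD1 i) //= eqxx mul1r big1 => [|k /negPf ->];
    last by rewrite mul0r.
  rewrite (bigD1 j) //= eqxx mul1r big1 => [|k /negPf ->];
    last by rewrite mul0r.
  by rewrite !addr0.
have /andP[+ _] := form x _ _ d_ge.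
have -> : \sum_k x k ^+ 2 = 2.
  under eq_bigr do rewrite expr2.
  have /negPf ji : j != i by rewrite eq_sym.
  by rewrite sumx /x !eqxx (negPf ij) ji /=; ring.
have -> : \sum_k \sum_l x k * A k l * x l = - 2 * (gdist e i j)%:R.
  under eq_bigr => k _ do [under eq_bigr do rewrite -mulrA [A _ _ * _]mulrC;
                           rewrite -mulr_sumr sumx].
  by rewrite sumx !mxE !gdistxx (gdist_sym j i e_sym); ring.
lra.
Qed.

(** The off-diagonal gaps t^2 - d_ij^2 are nonnegative and sum to 0, so all distances equal [t]. *)
Lemma complete_of_two_eigenvalues (R : realType) n (e : rel 'I_n) (t : R) :
  (1 < n)%N -> irreflexive e -> (forall i j, connect e i j) ->
  (forall i j, i != j -> (gdist e i j)%:R <= t) ->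
  \sum_i \sum_j (gdist e i j)%:R ^+ 2 = n%:R * (n%:R - 1) * t ^+ 2 ->
  forall i j, e i j = (i != j).
Proof.
move=> n_gt1 e_irr e_conn g_le g2.
pose gap i j : R := t ^+ 2 - (gdist e i j)%:R ^+ 2.
have gap_ge0 i j : j != i -> 0 <= gap i j.
  move=> ji; have g := g_le i j; rewrite eq_sym in g.
  by rewrite subr_ge0 ler_pXn2r ?nnegrE ?(le_trans _ (g ji)) ?g.
have gap0 : \sum_i \sum_(j < n | j != i) gap i j = 0.
  transitivity (\sum_(i < n) ((n%:R - 1) * t ^+ 2) -
      \sum_i \sum_j (gdist e i j)%:R ^+ 2).
    rewrite -sumrB; apply: eq_bigr => i _.
    rewrite sumrB sum_const_neq; congr (_ - _).
    by rewrite [RHS](bigD1 i) //= gdistxx expr0n add0r.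
  by rewrite g2 big_const_ord iter_addr_0 -[_ *+ n]mulr_natl; ring.
have gE i j : i != j -> (gdist e i j)%:R = t.
  move=> ij; have g := g_le i j ij.
  have t_ge0 : 0 <= t by apply: le_trans g.
  move/eqP: gap0; rewrite psumr_eq0 => [/allP/(_ i (mem_index_enum i))|k _];
    last by rewrite sumr_ge0 // => l /gap_ge0.
  rewrite psumr_eq0 => [/allP/(_ j (mem_index_enum j))|l /gap_ge0 //].
  rewrite eq_sym ij /= subr_eq0 eqrXn2 // => /eqP; exact: esym.
(* A natural number equal to [t]: the distance between the first two vertices. *)
pose t0 := gdist e (Ordinal (ltnW n_gt1)) (Ordinal n_gt1).
move=> i j; case: (eqVneq i j) => [->|ij]; first by rewrite e_irr.
apply: (gdist_const_complete (t := t0)) ij => // k l kl.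
by apply/eqP; rewrite -(eqr_nat R) !gE.
Qed.

(** * Bounding the spectral radius by Kober's inequality *)

Lemma estrada_eigenvalues (R : realType) n (e : rel 'I_n) (d : 'I_n -> R) :
  char_poly (distance_matrix R e) = \prod_k ('X - (d k)%:P) ->
  distance_estrada_index R e = \sum_k expR (d k).
Proof. exact: sum_spectrum. Qed.

Lemma sum_distance_degreeR (R : realType) n (e : rel 'I_n) : symmetric e ->
  \sum_i (distance_degree e i)%:R = 2 * (wiener_index e)%:R :> R.
Proof. by move=> /sum_distance_degree W; rewrite -natr_sum W natrM. Qed.

Lemma distance_degree_gt0 n (e : rel 'I_n) i :
  (1 < n)%N -> (0 < distance_degree e i)%N.
Proof.
move=> n_gt1; have [j ij] : exists j : 'I_n, i != j.
  exists (if i == Ordinal (ltnW n_gt1) then Ordinal n_gt1 else Ordinal (ltnW n_gt1)).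
  by case: ifP => [/eqP->|/negbT].
by rewrite /distance_degree (bigD1 j) //= addn_gt0 gdist_gt0.
Qed.

Lemma kober_radius (R : realType) n (e : rel 'I_n) (mu : R) :
  (1 < n)%N -> symmetric e -> 0 <= mu ->
  \sum_i (distance_degree e i)%:R ^+ 2 <= n%:R * mu ^+ 2 ->
  Num.sqrt ((4 * (wiener_index e)%:R ^+ 2 -
             geometric_mean_degree R e ^+ 2 * n%:R) / (n%:R * (n%:R - 1))) <= mu.
Proof.
move=> n_gt1 e_sym mu_ge0 degs.
have n_gt0 : 0 < (n%:R : R) by rewrite ltr0n ltnW.
have n1_gt0 : 0 < (n%:R - 1 : R) by rewrite subr_gt0 ltr1n.
(* [Num.sqrt] is monotone on all of [R], so the sign of the radicand need not be examined. *)
rewrite -[leRHS](ger0_norm mu_ge0) -sqrtr_sqr; apply: ler_wsqrtr.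
rewrite ler_pdivrMr ?mulr_gt0 //.
have := kober (a := fun i => (distance_degree e i)%:R : R) (ltnW n_gt1).
rewrite sum_distance_degreeR // -/(geometric_mean_degree R e).
have D_gt0 i : 0 < ((distance_degree e i)%:R : R).
  by rewrite ltr0n distance_degree_gt0.
move=> /(_ D_gt0); have := ler_wpM2l (ltW n1_gt0) degs.
lra.
Qed.

(** * The complete graph *)

Lemma complete_gdist n (e : rel 'I_n) :
  (forall i j, e i j = (i != j)) -> forall i j, gdist e i j = (i != j).
Proof.
move=> eE i j; case: (eqVneq i j) => [->|ij]; first exact: gdistxx.
by apply/eqP; rewrite gdist_eq1 // eE.
Qed.

(** Here D = J - I, with J the all-ones matrix, so S - v_j = mu v_j, where S sums the entries of v.
    Either S = 0 and mu = -1, or summing over j gives (n-1) S = mu S. *)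
Lemma complete_eigenvalue (R : realType) n (e : rel 'I_n) (mu : R) :
  (forall i j, e i j = (i != j)) ->
  root (char_poly (distance_matrix R e)) mu -> mu = -1 \/ mu = n%:R - 1.
Proof.
move=> eE; rewrite -eigenvalue_root_char => /eigenvalueP[v vA v0].
pose S := \sum_i v 0 i.
have vE j : S - v 0 j = mu * v 0 j.
  move/rowP/(_ j): vA; rewrite !mxE => <-.
  rewrite /S (bigD1 j) //= addrAC subrr add0r.
  rewrite [RHS](bigD1 j) //= mxE gdistxx mulr0 add0r.
  by apply: eq_bigr => i ij; rewrite mxE complete_gdist // ij mulr1.
have [S0|S0] := eqVneq S 0; [left|right].
  have [j vj] : exists j, v 0 j != 0.
    apply/existsP; apply: contraNT v0 => /existsPn v_eq0.
    by apply/eqP/rowP => j; rewrite mxE; apply/eqP/negPn/v_eq0.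
  by apply: (mulIf vj); rewrite -vE S0 mulN1r add0r.
apply: (mulIf S0); rewrite mulr_sumr -(eq_bigr _ (fun j _ => vE j)).
by rewrite sumrB big_const_ord iter_addr_0 -/S -[S *+ n]mulr_natr; ring.
Qed.

Lemma complete_geometric_mean (R : realType) n (e : rel 'I_n) :
  (1 < n)%N -> (forall i j, e i j = (i != j)) ->
  (forall i, distance_degree e i = n.-1) /\ geometric_mean_degree R e = n.-1%:R.
Proof.
move=> n_gt1 eE; have degE i : distance_degree e i = n.-1.
  rewrite /distance_degree (eq_bigr _ (fun j _ => complete_gdist eE i j)).
  rewrite (bigD1 i) //= eqxx add0n (eq_bigr (fun=> 1%N)) => [|j]; last first.
    by rewrite eq_sym => ->.
  by rewrite (sum1_card (predC1 i)) cardC1 card_ord.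
split=> //; rewrite /geometric_mean_degree.
rewrite (eq_bigr (fun=> n.-1%:R)) => [|i _]; last by rewrite degE.
rewrite big_const_ord iter_mulr_1 -powR_mulrn // -powRrM divff ?powRr1 //.
by rewrite pnatr_eq0 -lt0n ltnW.
Qed.

Lemma complete_radius (R : realType) n (e : rel 'I_n) :
  (1 < n)%N -> symmetric e -> (forall i j, e i j = (i != j)) ->
  Num.sqrt ((4 * (wiener_index e)%:R ^+ 2 -
             geometric_mean_degree R e ^+ 2 * n%:R) / (n%:R * (n%:R - 1))) =
  n%:R - 1.
Proof.
move=> n_gt1 e_sym eE; have [degE ->] := complete_geometric_mean R n_gt1 eE.
have n_gt0 : 0 < (n%:R : R) by rewrite ltr0n ltnW.
have n1_gt0 : 0 < (n%:R - 1 : R) by rewrite subr_gt0 ltr1n.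
have n1E : n.-1%:R = n%:R - 1 :> R.
  by rewrite -subn1 natrB // ltnW.
have WE : 2 * (wiener_index e)%:R = n%:R * (n%:R - 1) :> R.
  rewrite -sum_distance_degreeR // (eq_bigr (fun=> n%:R - 1)).
    by rewrite big_const_ord iter_addr_0 mulr_natl.
  by move=> i _; rewrite degE.
rewrite -[RHS](ger0_norm (ltW n1_gt0)) -sqrtr_sqr; congr Num.sqrt.
have -> : 4 * (wiener_index e)%:R ^+ 2 = (2 * (wiener_index e)%:R) ^+ 2 :> R.
  by ring.
rewrite WE n1E; field.
by rewrite !gt_eqF.
Qed.

(* On {-1, n-1} the exponential agrees with an affine function, so its sum over
   the spectrum depends only on the trace. *)
Lemma complete_estrada (R : realType) n (d : 'I_n -> R) :
  (0 < n)%N -> \sum_k d k = 0 -> (forall k, d k = -1 \/ d k = n%:R - 1) ->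
  \sum_k expR (d k) = expR (n%:R - 1) + (n%:R - 1) / expR 1.
Proof.
move=> n_gt0 d0 dE; have nR : 0 < (n%:R : R) by rewrite ltr0n.
pose B := (expR (n%:R - 1) - expR (-1)) / n%:R : R.
have affine k : expR (d k) = expR (-1) + B + B * d k.
  have -> : expR (-1) + B + B * d k = expR (-1) + B * (1 + d k) by ring.
  case: (dE k) => ->; first by rewrite subrr mulr0 addr0.
  have -> : 1 + (n%:R - 1) = n%:R :> R by ring.
  by rewrite /B divfK ?gt_eqF //; ring.
rewrite (eq_bigr _ (fun k _ => affine k)) big_split /= -mulr_sumr d0 mulr0 addr0.
rewrite big_const_ord iter_addr_0 -[_ *+ n]mulr_natr [LHS]mulrDl /B.
rewrite divfK ?gt_eqF //.
by rewrite expRN; ring.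
Qed.

(** * The two bounds and their equality cases *)

Theorem theorem1 (R : realType) (n : nat) (e : rel 'I_n)
    (n_gt0 : (0 < n)%N)
    (e_sym : symmetric e) (e_irr : irreflexive e)
    (e_connected : forall i j : 'I_n, connect e i j) :
  let W : R := (wiener_index e)%:R in
  let M : R := geometric_mean_degree R e in
  let Delta : R := (gdiameter e)%:R in
  let DEE : R := distance_estrada_index R e in
  let r : R :=
    Num.sqrt ((4 * W ^+ 2 - M ^+ 2 * n%:R) / (n%:R * (n%:R - 1))) in
  let lower : R :=
    if n == 1%N then 1
    else expR r + (n%:R - 1) / expR ((n%:R - 1)^-1 * r) in
  let upper : R :=
    n%:R - 1 + expR (Num.sqrt 2 * Num.sqrt Delta * Num.sqrt W) in
  [/\ lower <= DEE <= upper,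
      lower = DEE <-> (forall i j : 'I_n, e i j = (i != j)) &
      DEE = upper <-> n = 1%N].
Proof.
move=> W M Delta DEE r lower upper.
have [d [m [charD trD trD2 degs [dm_ge0 d_const]]]] :=
  distance_spectrum R n_gt0 e_sym.
have DEE_sum : DEE = \sum_k expR (d k) := estrada_eigenvalues charD.
have sumW : \sum_i \sum_j (gdist e i j)%:R = 2 * W :> R.
  by rewrite -sum_distance_degreeR //; apply: eq_bigr => i _; rewrite natr_sum.
pose b := Num.sqrt 2 * Num.sqrt Delta * Num.sqrt W.
have b_ge0 : 0 <= b by rewrite !mulr_ge0 ?sqrtr_ge0.
have d2_le_b2 : \sum_k d k ^+ 2 <= b ^+ 2.
  (* Entrywise, d_ij^2 <= Delta d_ij, and the distances sum to 2W. *)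
  rewrite trD2 !exprMn !sqr_sqrtr ?ler0n // mulrAC mulrC -sumW mulr_sumr.
  apply: ler_sum => i _; rewrite mulr_sumr; apply: ler_sum => j _.
  by rewrite expr2 ler_wpM2r // ler_nat gdist_le_diameter.
have le_upper : DEE <= n%:R - 1 + expR b - b.
  by rewrite DEE_sum; apply: sum_expR_le.
move: n_gt0; rewrite leq_eqVlt => /predU1P[n1|n_gt1].
  have all_eq : forall i j : 'I_n, i = j by rewrite -n1 => i j; rewrite !ord1.
  have d_eq0 k : d k = 0.
    by rewrite -trD (bigD1 k) //= big1 ?addr0 // => i; rewrite (all_eq i k) eqxx.
  have DEE1 : DEE = 1.
    rewrite DEE_sum (eq_bigr (fun=> 1)) => [|k _]; last by rewrite d_eq0 expR0.
    by rewrite big_const_ord iter_addr_0 -n1.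
  have W0 : W = 0.
    have : 2 * W = 0.
      rewrite -sumW big1 // => i _; rewrite big1 // => j _.
      by rewrite (all_eq i j) gdistxx.
    by move/eqP; rewrite mulf_eq0 pnatr_eq0 => /eqP.
  have upper1 : upper = 1.
    by rewrite /upper W0 sqrtr0 mulr0 expR0 -n1 subrr add0r.
  have -> : lower = 1 by rewrite /lower -n1.
  rewrite DEE1 upper1 lexx; split=> //; split=> // _ i j.
  by rewrite (all_eq i j) e_irr eqxx.
(* For n >= 2, b > 0 makes the upper bound strict. *)
have b_gt0 : 0 < b.
  have W_gt0 : 0 < W.
    rewrite -(pmulr_rgt0 (x := 2)) // -sum_distance_degreeR // (bigD1 m) //=.
    by rewrite ltr_pwDl ?sumr_ge0 // ltr0n distance_degree_gt0.
  rewrite !mulr_gt0 ?sqrtr_gt0 // ltr0n.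
  have : (0 < distance_degree e m)%N by rewrite distance_degree_gt0.
  case: (posnP (gdiameter e)) => // D0; rewrite /distance_degree big1 // => j _.
  by apply/eqP; rewrite -leqn0 -D0 gdist_le_diameter.
have lt_upper : DEE < upper.
  by apply: le_lt_trans le_upper _; rewrite /upper -/b gtrBl.
have n_neq1 : n == 1%N = false by rewrite gtn_eqF.
have r_le : r <= d m := kober_radius n_gt1 e_sym dm_ge0 degs.
have r_ge0 : 0 <= r by exact: sqrtr_ge0.
have [le_lower eq_lower] : lower <= \sum_k expR (d k) /\
    (lower = \sum_k expR (d k) ->
     d m = r /\ forall k, k != m -> d k = - ((n%:R - 1)^-1 * r)).
  by rewrite /lower n_neq1; apply: sum_expR_ge => //; rewrite r_ge0.
have n1_gt0 : 0 < (n%:R - 1 : R) by rewrite subr_gt0 ltr1n.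
split; last 1 first.
- by split=> [E|n1]; [rewrite E ltxx in lt_upper | rewrite n1 in n_gt1].
- by rewrite DEE_sum le_lower -DEE_sum ltW.
split=> [|eE].
  rewrite DEE_sum => /eq_lower[dm dk].
  have c_le : - ((n%:R - 1)^-1 * r) <= d m.
    by rewrite (le_trans _ dm_ge0) // oppr_le0 mulr_ge0 // invr_ge0 ltW.
  have g_le := d_const _ c_le dk; rewrite opprK in g_le.
  apply: (complete_of_two_eigenvalues n_gt1 e_irr e_connected g_le).
  (* With t = r/(n-1), the squared eigenvalues sum to r^2 + (n-1) t^2 = n(n-1) t^2. *)
  rewrite -trD2 (bigD1 m) //= dm.
  rewrite (eq_bigr (fun=> ((n%:R - 1)^-1 * r) ^+ 2)) => [|k km]; last first.
    by rewrite dk // sqrrN.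
  by rewrite sum_const_neq; field; rewrite gt_eqF.
have rE : r = n%:R - 1 := complete_radius R n_gt1 e_sym eE.
have d_cases k : d k = -1 \/ d k = n%:R - 1.
  apply: (complete_eigenvalue eE).
  by rewrite charD (bigD1 k) //= rootM root_XsubC eqxx.
rewrite DEE_sum (complete_estrada (ltnW n_gt1) trD d_cases).
by rewrite /lower n_neq1 rE mulVf // gt_eqF.
Qed.
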